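(* Let $\omega>0$, let $c_0\ne0$ be a real constant, and let $\gamma>1$. Consider the autonomous ODE system for a real symmetric $2\times2$ matrix $R(t)$ and a real $2\times2$ matrix $Q(t)$ (7 scalar unknowns) $$\dot R+RQ+Q^{T}R+(\gamma-1)(\operatorname{tr}Q)\,R=0,\qquad \dot Q+Q^2+2\omega LQ+2c_0R-\omega^2\mathcal E=0,$$ where $L=\begin{pmatrix}0&-1\\1&0\end{pmatrix}$ and $\mathcal E$ is the $2\times 2$ identity matrix. For every $b_*\in\mathbb R$, the equilibrium $$Q_*=\begin{pmatrix}0&b_*\\-b_*&0\end{pmatrix},\qquad R_*=\frac{(\omega-b_* )^2}{2c_0}\,\mathcal E$$ of this system is unstable.
   Context: ''Unstable'' means not stable in the sense of Lyapunov, as an equilibrium of the ODE system in the 7-dimensional space of pairs $(R,Q)$ with $R$ a symmetric and $Q$ an arbitrary real $2\times2$ matrix. (The system describes motions with linear velocity profile ${\bf u}(t,{\bf x})=Q(t){\bf x}$ of a polytropic gas with heat ratio $\gamma$ on a rotating plane, with Coriolis parameter $l=2\omega\sin\theta$ and with the centrifugal term included, in the case $\sin\theta=1$, so that $l=2\omega$.) *)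

(* Defs.v *)
From mathcomp Require Import all_boot all_order all_algebra.
From mathcomp Require Import all_classical all_reals all_analysis.
Set Implicit Arguments.
Unset Strict Implicit.
Unset Printing Implicit Defensive.
Import Order.TTheory GRing.Theory Num.Theory.
Import numFieldNormedType.Exports.
Local Open Scope classical_set_scope.
Local Open Scope ring_scope.

(* A solution on [0, T[ of the autonomous system x' = f x with phase space D.
   Asking for the equation on ]0, T[ and for continuity on [0, T[ leaves the
   values of x outside [0, T[ irrelevant; when f is continuous it amounts to
   asking for the one-sided derivative at 0. *)
Definition is_solution (R : realType) (V : normedModType R)
    (D : set V) (f : V -> V) (T : R) (x : R -> V) : Prop :=
  [/\ forall t : R, 0 <= t < T -> D (x t),
      {within `[0, T[, continuous x} &
      forall t : R, 0 < t < T -> is_derive t 1 x (f (x t))].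

(* T is arbitrary, so that solutions that blow up in finite time are covered
   as well as global ones. *)
Definition lyapunov_stable (R : realType) (V : normedModType R)
    (D : set V) (f : V -> V) (p : V) : Prop :=
  forall eps : R, 0 < eps -> exists2 delta : R, 0 < delta &
    forall (T : R) (x : R -> V), is_solution D f T x ->
      `|x 0 - p| < delta -> forall t : R, 0 <= t < T -> `|x t - p| < eps.

Definition is_equilibrium (R : realType) (V : normedModType R)
    (D : set V) (f : V -> V) (p : V) : Prop := D p /\ f p = 0.

Definition unstable_equilibrium (R : realType) (V : normedModType R)
    (D : set V) (f : V -> V) (p : V) : Prop :=
  is_equilibrium D f p /\ ~ lyapunov_stable D f p.

Definition mx2 (R : realType) (a b c d : R) : 'M[R]_2 :=
  \matrix_(i, j) nth 0 (nth [::] [:: [:: a; b]; [:: c; d]] i) j.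

Definition Lmx (R : realType) : 'M[R]_2 := mx2 0 (-1) 1 0.

(* Pairs (R, Q) are elements of 'M_2 * 'M_2; the 7-dimensional phase space is
   the linear subspace of the pairs whose first component is symmetric. *)
Definition phase_space (R : realType) : set ('M[R]_2 * 'M[R]_2)%type :=
  [set z | z.1^T = z.1].

Definition gas_field (R : realType) (omega c0 gamma : R)
    (z : ('M[R]_2 * 'M[R]_2)%type) : ('M[R]_2 * 'M[R]_2)%type :=
  let: (A, Q) := z in
  (- (A *m Q + Q^T *m A + ((gamma - 1) * \tr Q) *: A),
   - (Q *m Q + (2 * omega) *: (Lmx R *m Q) + (2 * c0) *: A
      - omega ^+ 2 *: 1%:M)).

Definition Q_star (R : realType) (b : R) : 'M[R]_2 := mx2 0 b (- b) 0.

Definition R_star (R : realType) (omega c0 b : R) : 'M[R]_2 :=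
  ((omega - b) ^+ 2 / (2 * c0)) *: 1%:M.

(* Main.v *)
Require Import Defs.
From HB Require Import structures.
From mathcomp Require Import all_boot all_order all_algebra.
From mathcomp Require Import all_classical all_reals all_analysis.
From mathcomp Require Import ring lra zify.
Set Implicit Arguments.
Unset Strict Implicit.
Unset Printing Implicit Defensive.
Import Order.TTheory GRing.Theory Num.Theory.
Import numFieldNormedType.Exports.
Local Open Scope ring_scope.

(* In an inertial frame the gas is free: with [Q = F' F^-1] the motion is
   [F'' = - a^2 (det F)^(1 - gamma) F^-T], [a = omega - b]. For
   [F z = alpha z + beta conj z] (complex notation) the equation of [beta] at the
   equilibrium linearizes to [beta'' = a^2 beta], whatever [gamma] is. Hence in
   a frame rotating at the constant rate [a / 2] the system for [(R, Q)], which
   is still autonomous and quadratic, has the real eigenvalue [|a|].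

   A field [u |-> u A + B(u, u)] for which [A] has a real eigenvalue [> 0] has
   a nonzero solution on a half-line [t < tau] tending to [0] at [-oo]: a power
   series in [exp (l t)], where [l > 0] is the largest multiple of that
   eigenvalue that is again an eigenvalue, so that no resonance [n l], [n >= 2],
   occurs. Translating such a solution in time contradicts stability. For
   [a = 0] the solution [R = 0], [Q = - omega L + t^-1 E], [t < 0], has the same
   property. *)

(** * Bounds for matrices and quadratic recurrences *)

Lemma le_mx_norm_entry (R : realType) m n (M : 'M[R]_(m, n)) i j :
  `|M i j| <= `|M|.
Proof.
by rewrite [leRHS]/Num.Def.normr/= mx_normrE; apply: (le_bigmax _ _ (i, j)).
Qed.

Lemma mx_norm_le_entry (R : realType) m n (M : 'M[R]_(m, n)) (C : R) :
  0 <= C -> (forall i j, `|M i j| <= C) -> `|M| <= C.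
Proof.
move=> C0 MC; rewrite [leLHS]/Num.Def.normr/= mx_normrE.
by apply/bigmax_leP; split => // -[i j] _; exact: MC.
Qed.

Lemma norm_mulmx (R : realType) m n p (M : 'M[R]_(m, n)) (N : 'M[R]_(n, p)) :
  `|M *m N| <= n%:R * `|M| * `|N|.
Proof.
apply: mx_norm_le_entry => [|i j]; first by rewrite !mulr_ge0.
rewrite mxE (le_trans (ler_norm_sum _ _ _))//.
apply: (@le_trans _ _ (\sum_(k < n) `|M| * `|N|)); last first.
  by rewrite sumr_const card_ord -mulrA mulr_natl.
by apply: ler_sum => k _; rewrite normrM ler_pM// le_mx_norm_entry.
Qed.

Lemma linear_row_bounded (R : realType) d m n
    (M : {linear 'rV[R]_d -> 'M[R]_(m, n)}) :
  exists2 C : R, 0 <= C & forall u, `|M u| <= C * `|u|.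
Proof.
exists (\sum_(j < d) `|M 'e_j|); first exact: sumr_ge0.
move=> u; rewrite [in leLHS](row_sum_delta u) linear_sum mulr_suml.
rewrite (le_trans (ler_norm_sum _ _ _))//; apply: ler_sum => j _.
by rewrite linearZ/= normrZ mulrC ler_pM// le_mx_norm_entry.
Qed.

Lemma natmul_archi (R : realType) (l C : R) : 0 < l ->
  exists N : nat, forall n, (N <= n)%N -> C <= n%:R * l.
Proof.
move=> l0; exists (Num.trunc `|C / l|).+1 => n Nn.
rewrite -ler_pdivrMr// (le_trans (ler_norm _))//.
by rewrite (le_trans (ltW (truncnS_gt _)))// ler_nat.
Qed.

Lemma eigenvalue_norm_le (R : realType) d (A : 'M[R]_d) (l : R) :
  eigenvalue A l -> `|l| <= d%:R * `|A|.
Proof.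
move=> /eigenvalueP[v vA v0].
have v1 : 0 < `|v| by rewrite normr_gt0.
by rewrite -(ler_pM2r v1) -normrZ -vA (le_trans (norm_mulmx _ _))// mulrAC.
Qed.

(** Eigenvalues are bounded by [d * |A|], so only finitely many multiples of [l] are eigenvalues.
    For the largest of them, [k], any [n * k] with [n >= 2] is a strictly larger multiple of [l]. *)
Lemma max_eigenvalue_multiple (R : realType) d (A : 'M[R]_d) (l : R) :
  0 < l -> eigenvalue A l -> exists2 k : R, 0 < k &
    eigenvalue A k /\ forall n, (1 < n)%N -> ~~ eigenvalue A (n%:R * k).
Proof.
(* The shift to [n.+1] keeps the multiples positive. The index of [n * (m.+1 * l)] is then
   [(n * m.+1).-1], which exceeds [m] as soon as [n >= 2]. *)
move=> l0 Al; pose P n := eigenvalue A (n.+1%:R * l).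
have P0 : exists n, P n by exists 0; rewrite /P mul1r.
have [N NP] := @natmul_archi R l (d%:R * `|A| + 1) l0.
have Pub n : P n -> (n <= N)%N.
  move=> Pn; rewrite leqNgt; apply/negP => Nn.
  have := NP n.+1 (leqW (ltnW Nn)); apply/negP; rewrite -ltNge.
  rewrite (le_lt_trans (ler_norm _))// (le_lt_trans (eigenvalue_norm_le Pn))//.
  by rewrite ltrDl.
case: (ex_maxnP P0 Pub) => m Pm mmax.
exists (m.+1%:R * l); first by rewrite mulr_gt0.
split=> // n n1; apply/negP; rewrite mulrA -natrM => Pn.
have : ((n * m.+1).-1 <= m)%N by apply: mmax; rewrite /P prednK// muln_gt0 ltnW.
by nia.
Qed.

(** The point is that [K] is uniform in [n]. Once [n l >= d |A| + 1], the equation gives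
    [|u| <= |g|] directly; the finitely many smaller [n] are covered by the norms of their
    inverses. *)
Lemma resolvent_bounded (R : realType) d (A : 'M[R]_d) (l : R) : 0 < l ->
  (forall n, (1 < n)%N -> ~~ eigenvalue A (n%:R * l)) ->
  exists2 K : R, 0 <= K & forall n (g : 'rV[R]_d), (1 < n)%N ->
    exists2 u, (n%:R * l) *: u = u *m A + g & `|u| <= K * `|g|.
Proof.
move=> l0 lA; pose S n := (n%:R * l)%:M - A.
have Su n : (1 < n)%N -> S n \in unitmx.
  move=> /lA /negPn; rewrite kermx_eq0 row_free_unit => uA.
  by rewrite /S -opprB -scaleN1r unitmxZ ?unitrN1.
have [N NP] := @natmul_archi R l (d%:R * `|A| + 1) l0.
(* The terms [n = 0, 1], where [S n] may be singular and [invmx] returns a default value, only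
   enlarge [K]. *)
pose K := 1 + \sum_(n < N) d%:R * `|invmx (S n)|.
have sum0 : 0 <= \sum_(n < N) d%:R * `|invmx (S n)|.
  by apply: sumr_ge0 => i _; rewrite mulr_ge0.
exists K; first by rewrite addr_ge0.
move=> n g n1.
have uS : (g *m invmx (S n)) *m S n = g by rewrite mulmxKV// Su.
set u := g *m invmx (S n) in uS *.
have uE : (n%:R * l) *: u = u *m A + g.
  by rewrite -[in RHS]uS mulmxBr mul_mx_scalar addrC subrK.
exists u => //.
have [Nn|nN] := leqP N n; last first.
  rewrite (le_trans (norm_mulmx _ _))// mulrAC ler_wpM2r// /K.
  rewrite (bigD1 (Ordinal nN))//= addrCA lerDl addr_ge0//.
  by apply: sumr_ge0 => i _; rewrite mulr_ge0.
have nl := NP _ Nn.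
have nl0 : 0 <= n%:R * l by rewrite mulr_ge0// ltW.
have : `|u| <= `|g|.
  have gE : g = (n%:R * l) *: u - u *m A by rewrite uE addrC addKr.
  rewrite gE (le_trans _ (lerB_dist _ _))// normrZ (ger0_norm nl0).
  rewrite lerBrDr (le_trans (lerD (lexx _) (norm_mulmx _ _)))//.
  by rewrite mulrAC -{1}[`|u|]mul1r -mulrDl ler_wpM2r// addrC.
by move/le_trans; apply; rewrite ler_peMl// lerDl.
Qed.

(** Both sides run over the pairs with [i + j < N]. Passing from [N] to [N.+1] adds the antidiagonal
    [i + j = N]: one term [(i, N - i)] to each row [i < N], and a new row [i = N] reduced to
    [j = 0]. *)
Lemma sum_antidiagonals (V : zmodType) (f : nat -> nat -> V) N :
  \sum_(n < N) \sum_(k < n.+1) f k (n - k)%N =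
  \sum_(i < N) \sum_(j < N | (i + j < N)%N) f i j.
Proof.
elim: N => [|N IH]; first by rewrite !big_ord0.
rewrite big_ord_recr/= IH [RHS]big_ord_recr/=.
rewrite [X in _ = _ + X](bigD1 ord0)/= ?addn0 ?ltnSn//.
rewrite [X in _ = _ + (_ + X)]big1 ?addr0; last first.
  by move=> j /andP[Nj]; rewrite -val_eqE/= => j0; lia.
rewrite [X in _ + X = _]big_ord_recr/= subnn addrA; congr (_ + _).
rewrite -big_split/=; apply: eq_bigr => i _.
have iN : (N - i < N.+1)%N by rewrite ltnS leq_subr.
rewrite [RHS](bigD1 (Ordinal iN))/= ?subnKC ?ltnSn// 1?ltnW// addrC.
congr (_ + _).
rewrite [RHS]big_mkcond big_ord_recr/= [X in _ = _ + X]ifF ?addr0; last first.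
  by rewrite -val_eqE/=; have := ltn_ord i; lia.
rewrite big_mkcond; apply: eq_bigr => j _; congr (if _ then _ else _).
by rewrite -val_eqE/=; have := ltn_ord i; lia.
Qed.

Lemma le_sum_antidiagonals (R : realType) (x y : nat -> R) N :
  (forall n, 0 <= x n) -> (forall n, 0 <= y n) ->
  \sum_(n < N) \sum_(k < n.+1) x k * y (n - k)%N <=
  (\sum_(n < N) x n) * (\sum_(n < N) y n).
Proof.
move=> x0 y0; rewrite (sum_antidiagonals (fun i j => x i * y j)) big_distrl/=.
apply: ler_sum => i _; rewrite big_distrr/= big_mkcond/=.
by apply: ler_sum => j _; case: ifP => // _; rewrite mulr_ge0.
Qed.

(** The partial sums [s_N] of [b n * rho ^+ n] satisfy [s_(N+1) <= b 0 + rho C s_N ^ 2]. With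
    [T = b 0 + 1] and [rho = 1 / (C T ^ 2 + 1)] one has [rho C T ^ 2 <= 1], so the bound [s_N <= T]
    propagates. *)
Lemma quadratic_recurrence_bounded (R : realType) (C : R) (b : nat -> R) :
  0 <= C -> (forall n, 0 <= b n) ->
  (forall n, b n.+1 <= C * \sum_(k < n.+1) b k * b (n - k)%N) ->
  exists2 rho : R, 0 < rho &
    forall N, \sum_(n < N) b n * rho ^+ n <= b 0%N + 1.
Proof.
move=> C0 b0 bC; set T := b 0%N + 1.
have T0 : 0 <= T by rewrite addr_ge0.
have CT : 0 < C * T ^+ 2 + 1 by rewrite ltr_wpDl// mulr_ge0// exprn_ge0.
pose rho := (C * T ^+ 2 + 1)^-1.
have rho0 : 0 < rho by rewrite invr_gt0.
exists rho => //; elim=> [|N IH]; first by rewrite big_ord0.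
have x0 n : 0 <= b n * rho ^+ n by rewrite mulr_ge0// exprn_ge0// ltW.
rewrite big_ord_recl expr0 mulr1 lerD2l.
apply: (@le_trans _ _ (rho * C * T ^+ 2)); last first.
  by rewrite -mulrA mulrC ler_pdivrMr// mul1r lerDl.
apply: (@le_trans _ _ (rho * C * ((\sum_(n < N) b n * rho ^+ n) *
    (\sum_(n < N) b n * rho ^+ n)))); last first.
  rewrite ler_wpM2l ?expr2 ?ler_pM//; first by rewrite mulr_ge0// ltW.
  - exact: sumr_ge0.
  - exact: sumr_ge0.
apply: le_trans; last first.
  apply: ler_wpM2l; first by rewrite mulr_ge0// ltW.
  exact: (@le_sum_antidiagonals R (fun n => b n * rho ^+ n) (fun n => b n * rho ^+ n)).
rewrite mulr_sumr; apply: ler_sum => n _; rewrite lift0.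
apply: (le_trans (ler_wpM2r (exprn_ge0 _ (ltW rho0)) (bC n))).
rewrite le_eqVlt; apply/orP; left; apply/eqP.
rewrite [X in _ = _ * X](_ : _ =
  (\sum_(k < n.+1) b k * b (n - k)%N) * rho ^+ n); first by rewrite exprS; ring.
rewrite mulr_suml; apply: eq_bigr => k _.
by rewrite mulrACA -exprD subnKC// -ltnS.
Qed.

(** * Power series solutions of quadratic systems *)

(** Course-of-values recursion. Each application of [G] makes one more value final: the value at [n]
    no longer changes after [n.+1] iterations, whatever the initial function. *)
Lemma strong_recursion (T : Type) (x0 : T) (Phi : nat -> (nat -> T) -> T) :
  (forall n f g, (forall k, (k <= n)%N -> f k = g k) -> Phi n f = Phi n g) ->
  exists2 c : nat -> T, c 0%N = x0 & forall n, c n.+1 = Phi n c.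
Proof.
move=> PhiE; pose G (f : nat -> T) n := if n is m.+1 then Phi m f else x0.
have stable n m : (n < m)%N ->
    iter m G (fun=> x0) n = iter n.+1 G (fun=> x0) n.
  elim/ltn_ind: n m => -[|n] IH [|m]//= nm.
  apply: PhiE => k kn.
  have {}IH := IH k kn.
  by rewrite (IH m (leq_ltn_trans kn nm)); apply/esym/(IH n.+1).
exists (fun n => iter n.+1 G (fun=> x0) n) => // n /=.
by apply: PhiE => k kn; rewrite -[LHS]/(iter n.+1 G (fun=> x0) k) stable.
Qed.

(** These are the coefficients of the formal solution [z = sum_n c_n s^(n+1)], [s = exp (l t)], of
    [z' = z A + z M(z)]. Since [c n.+1] goes with [s^(n+2)], it is found by inverting
    [(n + 2) l - A], which is possible without resonance. The uniform resolvent bound turns the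
    recursion into a quadratic inequality for [|c n|], whence a positive radius of convergence. *)
Lemma branch_coefficients (R : realType) d (A : 'M[R]_d)
    (M : {linear 'rV[R]_d -> 'M[R]_d}) (l : R) : 0 < l -> eigenvalue A l ->
  (forall n, (1 < n)%N -> ~~ eigenvalue A (n%:R * l)) ->
  exists c : nat -> 'rV[R]_d, [/\ c 0%N != 0, l *: c 0%N = c 0%N *m A,
    forall n, (n.+2%:R * l) *: c n.+1 =
      c n.+1 *m A + \sum_(k < n.+1) c k *m M (c (n - k)%N) &
    exists rho S : R, 0 < rho /\
      forall N, \sum_(n < N) `|c n| * rho ^+ n <= S].
Proof.
move=> l0 /eigenvalueP[v vA v0] lA.
have [K K0 Kres] := resolvent_bounded l0 lA.
have [C C0 MC] := linear_row_bounded M.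
have /choice[res resP] (ng : nat * 'rV[R]_d) : exists u,
    (ng.1.+2%:R * l) *: u = u *m A + ng.2 /\ `|u| <= K * `|ng.2|.
  by have [u] := Kres ng.1.+2 ng.2 isT; exists u.
pose Phi n (c : nat -> 'rV[R]_d) :=
  res (n, \sum_(k < n.+1) c k *m M (c (n - k)%N)).
have [|c c0 cS] := @strong_recursion _ v Phi.
  move=> n f g fg; rewrite /Phi; congr (res (_, _)); apply: eq_bigr => k _.
  by rewrite !fg ?leq_subr// -ltnS.
exists c; split; [by rewrite c0|by rewrite c0 vA| |].
  by move=> n; rewrite cS /Phi; exact: (resP (n, _)).1.
have [|n|n|rho rho0 rhoP] := @quadratic_recurrence_bounded R
  (K * (d%:R * C)) (fun n => `|c n|).
- by rewrite !mulr_ge0.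
- by [].
- rewrite cS (le_trans (resP (n, _)).2)//= -mulrA ler_wpM2l//.
  rewrite (le_trans (ler_norm_sum _ _ _))// mulr_sumr; apply: ler_sum => k _.
  rewrite (le_trans (norm_mulmx _ _))// -!mulrA ler_wpM2l//.
  by rewrite [leRHS]mulrCA ler_wpM2l.
by exists rho, (`|c 0%N| + 1).
Qed.

Lemma cvg_pseries_bounded (R : realType) (c : nat -> R) (rho S x : R) :
  0 < rho -> (forall n, `|c n| * rho ^+ n <= S) -> `|x| < rho ->
  cvgn (pseries c x).
Proof.
move=> rho0 cS xrho; apply: normed_cvg.
have S0 : 0 <= S by apply: le_trans (cS 0%N); rewrite mulr_ge0.
apply: (@series_le_cvg _ _ (geometric S (`|x| / rho))) => [n|n|n|].
- exact: normr_ge0.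
- by rewrite /geometric/= mulr_ge0// exprn_ge0// divr_ge0// ltW.
- rewrite /geometric/= normrM normrX expr_div_n.
  rewrite (_ : S * _ = S / rho ^+ n * `|x| ^+ n); last by ring.
  by rewrite ler_wpM2r ?exprn_ge0// ler_pdivlMr ?exprn_gt0.
- apply: is_cvg_geometric_series.
  by rewrite ger0_norm ?divr_ge0// 1?ltW// ltr_pdivrMr// mul1r.
Qed.

(** Halving the radius absorbs the factor [n + 1] produced by differentiation, because
    [n + 1 <= 2 ^ (n + 1)]. *)
Lemma pseries_diffs_bounded (R : realType) (c : nat -> R) (rho S : R) :
  0 < rho -> (forall n, `|c n| * rho ^+ n <= S) ->
  forall n, `|pseries_diffs c n| * (rho / 2) ^+ n <= 2 * S / rho.
Proof.
move=> rho0 cS n; rewrite /pseries_diffs normrM normr_nat expr_div_n.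
rewrite ler_pdivlMr// -[leLHS]mulrA.
rewrite (_ : _ * _ = (n.+1%:R / 2 ^+ n) * (`|c n.+1| * rho ^+ n.+1)); last first.
  by rewrite exprS; ring.
apply: ler_pM => //; rewrite ?mulr_ge0 ?invr_ge0 ?exprn_ge0// 1?ltW//.
rewrite ltr_pdivrMr ?exprn_gt0// -exprS -natrX ltr_nat.
exact: ltn_expl.
Qed.

Lemma is_derive_pseries_bounded (R : realType) (c : nat -> R) (rho S x : R) :
  0 < rho -> (forall n, `|c n| * rho ^+ n <= S) -> `|x| < rho / 8 ->
  is_derive x 1 (fun x => limn (pseries c x))
    (limn (pseries (pseries_diffs c) x)).
Proof.
move=> rho0 cS xrho; have rho2 : 0 < rho / 2 by rewrite divr_gt0.
have c1 := pseries_diffs_bounded rho0 cS.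
have c2 := pseries_diffs_bounded rho2 c1.
have K8 : `|rho / 8| = rho / 8 by rewrite ger0_norm// divr_ge0// ltW.
(* Termwise differentiation asks for convergence of the series and of its first two derived series
   at one point. Two halvings leave the radius [rho / 4], and [rho / 8] lies strictly inside. *)
apply: (@pseries_snd_diffs _ _ (rho / 8)); last by rewrite K8.
- by apply: cvg_pseries_bounded cS _; rewrite ?K8//; lra.
- by apply: cvg_pseries_bounded c1 _; rewrite ?K8//; lra.
- by apply: cvg_pseries_bounded c2 _; rewrite ?K8//; lra.
Qed.

Lemma cvg_sumr (R : realType) (I : Type) (r : seq I) (f : I -> nat -> R)
    (a : I -> R) :
  (forall i, (f i n @[n --> \oo] --> a i)%classic) ->
  (\sum_(i <- r) f i n @[n --> \oo] --> \sum_(i <- r) a i)%classic.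
Proof. by move=> fa; apply: cvg_big => //; exact: add_continuous. Qed.

Lemma mulmx_linear_entry (R : realType) d (M : {linear 'rV[R]_d -> 'M[R]_d})
    (u v : 'rV[R]_d) j : (u *m M v) 0 j =
  \sum_i u 0 i * \sum_k v 0 k * M 'e_k i j.
Proof.
rewrite mxE; apply: eq_bigr => i _; congr (_ * _).
rewrite [in LHS](row_sum_delta v) linear_sum summxE; apply: eq_bigr => k _.
by rewrite linearZ mxE.
Qed.

(* With [Y N] the [N]-th partial sum of [c] at [s], [|s| <= rho / 2], the terms of
   [Y N *m M (Y N)] of total degree at least [N],
   missing in the truncated Cauchy product, are [O(2^-N)]. *)
Lemma cauchy_product_cvg (R : realType) d
    (M : {linear 'rV[R]_d -> 'M[R]_d}) (c : nat -> 'rV[R]_d)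
    (rho S s : R) (y : 'rV[R]_d) :
  0 < rho -> (forall N, \sum_(n < N) `|c n| * rho ^+ n <= S) ->
  `|s| <= rho / 2 ->
  (forall i, (\sum_(n < N) s ^+ n * c n 0 i @[N --> \oo] --> y 0 i)%classic) ->
  forall j, ((\sum_(n < N)
      s ^+ n *: \sum_(k < n.+1) c k *m M (c (n - k)%N)) 0 j
    @[N --> \oo] --> (y *m M y) 0 j)%classic.
Proof.
move=> rho0 cS srho cy j.
have [C C0 MC] := linear_row_bounded M.
pose Y N : 'rV[R]_d := \sum_(n < N) s ^+ n *: c n.
have YE N i : Y N 0 i = \sum_(n < N) s ^+ n * c n 0 i.
  by rewrite /Y summxE; apply: eq_bigr => n _; rewrite mxE.
have YMY : ((Y N *m M (Y N)) 0 j @[N --> \oo] --> (y *m M y) 0 j)%classic.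
  rewrite mulmx_linear_entry; under eq_fun do rewrite mulmx_linear_entry.
  apply: cvg_sumr => i; apply: cvgM.
    by under eq_fun do rewrite YE; exact: cy.
  apply: cvg_sumr => k; apply: cvgM; last exact: cvg_cst.
  by under eq_fun do rewrite YE; exact: cy.
pose f (i k : nat) : 'rV[R]_d := s ^+ (i + k) *: (c i *m M (c k)).
pose W N : 'rV[R]_d := \sum_(n < N) s ^+ n *: \sum_(k < n.+1) c k *m M (c (n - k)%N).
have WE N : W N = Y N *m M (Y N) -
    \sum_(i < N) \sum_(k < N | ~~ (i + k < N)%N) f i k.
  apply/eqP; rewrite -subr_eq opprK; apply/eqP.
  rewrite /W /Y linear_sum mulmx_suml.
  under eq_bigr => n _.
    rewrite scaler_sumr; under eq_bigr => k _.
      rewrite (_ : _ *: _ = f k (n - k)%N); last first.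
        by rewrite /f subnKC// -ltnS.
      over.
    over.
  rewrite (sum_antidiagonals f) -big_split/=; apply: eq_bigr => i _.
  rewrite mulmx_sumr [RHS](bigID (fun k : 'I_N => (i + k < N)%N))/=.
  by congr (_ + _); apply: eq_bigr => k _;
    rewrite linearZ/= -scalemxAl -scalemxAr scalerA -exprD.
have tail N : `|(W N - Y N *m M (Y N)) 0 j| <=
    geometric (d%:R * C * S ^+ 2) 2^-1 N.
  rewrite (le_trans (le_mx_norm_entry _ _ _))// WE addrAC subrr sub0r normrN.
  rewrite (le_trans (ler_norm_sum _ _ _))//.
  pose x n := `|c n| * rho ^+ n.
  have x0 n : 0 <= x n by rewrite mulr_ge0// exprn_ge0// ltW.
  (* Here [i + k >= N] and [|s| <= rho / 2], so [|s| ^ (i + k) <= 2 ^ (- N) rho ^ (i + k)]; after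
     that the sum may be enlarged to the full square, which factors. *)
  apply: (@le_trans _ _ (\sum_(i < N) \sum_(k < N)
      d%:R * C * 2^-1 ^+ N * (x i * x k))).
    apply: ler_sum => i _; rewrite (le_trans (ler_norm_sum _ _ _))//.
    rewrite big_mkcond/=; apply: ler_sum => k _; case: ifPn => [|_]; last first.
      by rewrite !mulr_ge0// exprn_ge0// ltW.
    rewrite -leqNgt => Nik; rewrite /f normrZ normrX.
    apply: (@le_trans _ _ ((rho / 2) ^+ (i + k) * (d%:R * `|c i| * (C * `|c k|)))).
      apply: ler_pM => //.
        by rewrite lerXn2r// nnegrE divr_ge0// ltW.
      by rewrite (le_trans (norm_mulmx _ _))// ler_wpM2l// mulr_ge0.
    have : 2^-1 ^+ (i + k) <= 2^-1 ^+ N :> R.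
      by apply: ler_wiXn2l => //; lra.
    have dCx : 0 <= d%:R * C * (x i * x k).
      by rewrite mulr_ge0 ?(mulr_ge0 (x0 i) (x0 k))// mulr_ge0.
    move=> /(ler_wpM2r dCx); rewrite /x => h.
    apply: le_trans (le_trans h _).
      by rewrite le_eqVlt; apply/orP; left; apply/eqP; rewrite !exprMn !exprD; ring.
    by rewrite le_eqVlt; apply/orP; left; apply/eqP; ring.
  under eq_bigr do rewrite -mulr_sumr -mulr_sumr.
  rewrite -mulr_sumr -mulr_suml /geometric/= mulrAC.
  rewrite ler_wpM2r ?exprn_ge0 ?invr_ge0// ler_wpM2l ?mulr_ge0// expr2.
  by apply: ler_pM; rewrite ?sumr_ge0 ?cS.
apply: cvg_sub0 YMY; apply: norm_cvg0.
apply: (@squeeze_cvgr _ _ _ _ (fun=> 0) (geometric (d%:R * C * S ^+ 2) 2^-1)).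
- near=> N; rewrite normr_ge0/=; have := tail N.
  by rewrite [X in `|X| <= _ -> _]mxE [X in `|_ + X| <= _ -> _]mxE.
- exact: cvg_cst.
- by apply: cvg_geometric; rewrite ger0_norm; lra.
Unshelve. all: by end_near. Qed.

(** With [y(s) = sum_n c_n s^n], this is the differential equation of [z = s y(s)], [s = exp (l t)],
    divided by [s]. It follows by summing the recurrence up to a finite degree and comparing the
    limits of both sides. *)
Lemma branch_series_equation (R : realType) d (A : 'M[R]_d)
    (M : {linear 'rV[R]_d -> 'M[R]_d}) (l rho S s : R) (c : nat -> 'rV[R]_d)
    (y := \row_i limn (pseries (fun n => c n 0 i) s)) i :
  0 < rho -> (forall N, \sum_(n < N) `|c n| * rho ^+ n <= S) ->
  l *: c 0%N = c 0%N *m A ->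
  (forall n, (n.+2%:R * l) *: c n.+1 =
    c n.+1 *m A + \sum_(k < n.+1) c k *m M (c (n - k)%N)) ->
  (forall j n, `|c n 0 j| * rho ^+ n <= S) ->
  `|s| < rho / 8 ->
  l * (y 0 i + s * limn (pseries (pseries_diffs (fun n => c n 0 i)) s)) =
  (y *m (A + s *: M y)) 0 i.
Proof.
move=> rho0 cS c0A cn cb srho.
have cy j : (\sum_(n < N) s ^+ n * c n 0 j @[N --> \oo] --> y 0 j)%classic.
  have : cvgn (pseries (fun n => c n 0 j) s).
    by apply: cvg_pseries_bounded (cb j) _ => //; lra.
  rewrite mxE; apply: cvg_trans; apply: near_eq_cvg; near=> N.
  by rewrite /pseries /series/= big_mkord; apply: eq_bigr => n _; rewrite mulrC.
have cdy : (\sum_(n < N) n.+1%:R * c n.+1 0 i * s ^+ n @[N --> \oo] -->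
    limn (pseries (pseries_diffs (fun n => c n 0 i)) s))%classic.
  have : cvgn (pseries (pseries_diffs (fun n => c n 0 i)) s).
    apply: cvg_pseries_bounded (pseries_diffs_bounded rho0 (cb i)) _; lra.
  apply: cvg_trans; apply: near_eq_cvg; near=> N.
  by rewrite /pseries /series/= big_mkord.
have cyA : (\sum_(n < N) s ^+ n * (c n *m A) 0 i @[N --> \oo] -->
    (y *m A) 0 i)%classic.
  rewrite [X in (_ --> X)%classic]mxE.
  rewrite (_ : (fun N => _) = (fun N : nat =>
      \sum_k (\sum_(n < N) s ^+ n * c n 0 k) * A k i)); last first.
    apply/funext => N; under [RHS]eq_bigr do rewrite mulr_suml.
    rewrite exchange_big; apply: eq_bigr => n _; rewrite mxE mulr_sumr.
    by apply: eq_bigr => k _; rewrite mulrA.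
  by apply: cvg_sumr => k; apply: cvgM => //; exact: cvg_cst.
have cW := @cauchy_product_cvg _ _ M c rho S s y rho0 cS _ cy i.
have {}cW := cW (_ : `|s| <= rho / 2).
have {}cW : ((\sum_(n < N)
      s ^+ n *: \sum_(k < n.+1) c k *m M (c (n - k)%N)) 0 i
    @[N --> \oo] --> (y *m M y) 0 i)%classic by apply: cW; lra.
pose q n := (c n *m A) 0 i.
pose w n := (\sum_(k < n.+1) c k *m M (c (n - k)%N)) 0 i.
(* The factor [s] shifts degrees by one, hence [N.+1] terms of [y] against [N] of its derivative:
   [u N] is exactly the truncation at degree [N], namely the sum of [(n + 1) l c_n s^n] for
   [n <= N]. *)
pose u N := l * (\sum_(n < N.+1) s ^+ n * c n 0 i +
  s * \sum_(n < N) n.+1%:R * c n.+1 0 i * s ^+ n).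
have q0 : l * c 0%N 0 i = q 0%N by rewrite /q -c0A mxE.
have qS n : n.+2%:R * l * c n.+1 0 i = q n.+1 + w n.
  by have := congr1 (fun v : 'rV[R]_d => v 0 i) (cn n); rewrite [LHS]mxE [RHS]mxE.
have uE N : u N = \sum_(n < N.+1) s ^+ n * q n +
    s * (\sum_(n < N) s ^+ n *: \sum_(k < n.+1) c k *m M (c (n - k)%N)) 0 i.
  rewrite /u summxE.
  under [X in _ = _ + s * X]eq_bigr do rewrite mxE -/(w _).
  elim: N => [|N IH]; first by rewrite !big_ord1 !big_ord0 -q0; ring.
  rewrite big_ord_recr/= [X in s * X]big_ord_recr/=.
  rewrite [in RHS]big_ord_recr/= [X in _ = _ + s * X]big_ord_recr/=.
  rewrite [s * (_ + _)]mulrDr addrACA mulrDr IH.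
  rewrite [X in _ = _ + X]mulrDr [RHS]addrACA; congr (_ + _).
  rewrite (_ : q N.+1 = N.+2%:R * l * c N.+1 0 i - w N); last by rewrite qS addrK.
  by rewrite exprS; ring.
have ul : (u N @[N --> \oo] -->
  l * (y 0 i + s * limn (pseries (pseries_diffs (fun n => c n 0 i)) s)))%classic.
  apply: cvgM; first exact: cvg_cst.
  apply: cvgD; last by apply: cvgM => //; exact: cvg_cst.
  by rewrite (cvg_shiftS (fun N => \sum_(n < N) s ^+ n * c n 0 i)).
have ur : (u N @[N --> \oo] --> (y *m A) 0 i + s * (y *m M y) 0 i)%classic.
  under eq_fun do rewrite uE.
  apply: cvgD; last by apply: cvgM => //; exact: cvg_cst.
  by rewrite (cvg_shiftS (fun N => \sum_(n < N) s ^+ n * (c n *m A) 0 i)).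
rewrite mulmxDr -scalemxAr [RHS]mxE [X in _ = _ + X]mxE.
exact: (cvg_unique _ ul ur).
Unshelve. all: by end_near. Qed.

Lemma pseries_at0 (R : realType) (c : nat -> R) : limn (pseries c 0) = c 0%N.
Proof.
apply: cvg_lim => //; rewrite -cvg_shiftS /pseries /series/=.
under eq_fun => n.
  rewrite big_mkord big_ord_recl/= expr0 mulr1 big1 ?addr0; first over.
  by move=> i _; rewrite expr0n mulr0.
exact: cvg_cst.
Qed.

(** The solution is [z t = s y(s)] with [s = exp (l t)] and [y(s) = sum_n c_n s^n]; the choice of
    [tau] keeps [s] below [rho / 8]. As [t] tends to [-oo], [s] tends to [0] and [y(s)] to
    [c 0 != 0], so [z] tends to [0] without vanishing there. *)
Lemma unstable_branch (R : realType) d (A : 'M[R]_d)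
    (M : {linear 'rV[R]_d -> 'M[R]_d}) (l : R) : 0 < l -> eigenvalue A l ->
  exists (tau : R) (z : R -> 'rV[R]_d), [/\
    forall t i, t < tau ->
      is_derive t 1 (fun t => z t 0 i) ((z t *m (A + M (z t))) 0 i),
    forall e, 0 < e -> exists T, forall t, t < T -> `|z t| < e &
    exists2 t, t < tau & z t != 0].
Proof.
move=> l0' Al; have [{l0' Al}l l0 [Al lA]] := max_eigenvalue_multiple l0' Al.
have [c [c0 c0A cn [rho [S [rho0 cS]]]]] := branch_coefficients M l0 Al lA.
have cb j n : `|c n 0 j| * rho ^+ n <= S.
  apply: le_trans (cS n.+1); rewrite big_ord_recr/= ler_wpDl//.
    by apply: sumr_ge0 => k _; rewrite mulr_ge0// exprn_ge0// ltW.
  by rewrite ler_wpM2r ?le_mx_norm_entry// exprn_ge0// ltW.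
pose Y i s : R := limn (pseries (fun n => c n 0 i) s).
pose y s := \row_i Y i s.
have dY i s := fun sr => @is_derive_pseries_bounded _ _ _ _ s rho0 (cb i) sr.
have rho8 : 0 < rho / 8 by rewrite divr_gt0.
have ltau t : t < ln (rho / 8) / l -> expR (l * t) < rho / 8.
  by rewrite ltr_pdivlMr// mulrC => ?; rewrite -ltr_ln ?posrE ?expR_gt0// expRK.
exists (ln (rho / 8) / l), (fun t => expR (l * t) *: y (expR (l * t))).
have Yc i : (Y i s @[s --> (0 : R)] --> Y i 0)%classic.
  have [|dY0 _] := dY i 0; first by rewrite normr0.
  exact/differentiable_continuous/derivable1_diffP.
(* A property valid near [s = 0] holds at [s = exp (l t)] for all sufficiently negative [t]. *)
have nearT (P : R -> Prop) : (\forall s \near (0 : R), P s) ->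
    exists T, forall t, t < T -> P (expR (l * t)).
  move=> /nbhs_ballP[r /= r0 rP]; exists (ln r / l) => t.
  rewrite ltr_pdivlMr// mulrC => tr; apply: rP.
  rewrite /ball/= sub0r normrN gtr0_norm ?expR_gt0//.
  by rewrite -ltr_ln ?posrE ?expR_gt0// expRK.
split.
- move=> t i /ltau tr; set s := expR (l * t).
  have s0 : 0 < s by exact: expR_gt0.
  have sr : `|s| < rho / 8 by rewrite gtr0_norm.
  rewrite [X in is_derive _ _ X](_ : _ =
    (fun s => s * Y i s) \o (fun t => expR (l * t))); last first.
    by apply/funext => x /=; rewrite !mxE.
  have dYs : is_derive s 1 (Y i) _ := dY i s sr.
  have ds : is_derive t 1 (fun t => expR (l * t)) (s * l).
    apply: (@is_derive1_comp _ expR (fun t => l * t)).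
    have := is_deriveZ l (is_derive_id t 1).
    by move/is_derive_eq; apply; rewrite /GRing.scale/= mulr1.
  have dg : is_derive s 1 (fun s => s * Y i s) _ :=
    is_deriveM (is_derive_id s 1) dYs.
  apply: is_derive_eq.
  have := branch_series_equation i rho0 cS c0A cn (fun j n => cb j n) sr.
  rewrite -/(Y i s) -/(y s) => yE.
  rewrite linearZ/= -scalemxAl [RHS]mxE -yE.
  by rewrite mxE /GRing.scale/=; ring.
- move=> e e0.
  have : \forall s \near (0 : R), forall i, `|s * Y i s| < e / 2.
    apply: (@filter_forall _ _ (fun i s => `|s * Y i s| < e / 2) (nbhs 0)) => i.
    apply: (cvgr0_norm_lt (fun s : R => s * Y i s)); last lra.
    rewrite -[X in (_ --> X)%classic](mul0r (Y i 0)).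
    by apply: cvgM; [exact: cvg_id | exact: Yc].
  move=> /nearT[T PT]; exists T => t tT.
  apply: le_lt_trans (_ : _ <= e / 2) _; last lra.
  apply: mx_norm_le_entry; first lra.
  move=> j i; rewrite ord1 !mxE; apply/ltW/(PT _ tT).
- have /rV0Pn[i ci] := c0.
  have : \forall s \near (0 : R), Y i s != 0.
    have := cvgr_neq0 (Y i 0) (Yc i); apply; by rewrite /Y pseries_at0.
  move=> /nearT[T PT]; pose t := Num.min T (ln (rho / 8) / l) - 1.
  have tT : t < T by rewrite /t ltrBlDr ltr_pwDr// ge_min lexx.
  have tt : t < ln (rho / 8) / l.
    by rewrite /t ltrBlDr ltr_pwDr// ge_min lexx orbT.
  exists t => //; apply/rV0Pn; exists i; rewrite !mxE mulf_neq0 ?PT//.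
  by rewrite gt_eqF// expR_gt0.
Qed.

(** * Instability from a branch issued from the equilibrium *)

Lemma is_derive_translate (R : realType) (V : normedModType R) (x : R -> V)
    (t0 t : R) (dx : V) :
  is_derive (t0 + t) 1 x dx -> is_derive t 1 (fun t => x (t0 + t)) dx.
Proof.
move=> xt.
have E : (fun h : R => h^-1 *: (((fun t => x (t0 + t)) \o shift t) (h *: 1) -
    x (t0 + t))) = (fun h : R => h^-1 *: ((x \o shift (t0 + t)) (h *: 1) -
    x (t0 + t))).
  by apply/funext => h /=; rewrite addrCA.
case: xt => dxt <-; apply: DeriveDef.
  by rewrite /derivable E.
by rewrite /derive E.
Qed.

Lemma is_derive_pair (R : realType) (V W : normedModType R) (f : R -> V)
    (g : R -> W) (t : R) (df : V) (dg : W) :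
  is_derive t 1 f df -> is_derive t 1 g dg ->
  is_derive t 1 (fun t => (f t, g t)) (df, dg).
Proof.
move=> [f1 <-] [g1 <-].
have fg : ((fun h : R => h^-1 *: (((fun t => (f t, g t)) \o shift t) (h *: 1) -
    (f t, g t))) h @[h --> 0^'] --> ('D_1 f t, 'D_1 g t))%classic.
  exact: (cvg_pair f1 g1).
apply: DeriveDef; first by apply/cvg_ex; eexists; exact: fg.
exact: (cvg_lim _ fg).
Qed.

Lemma is_derive_mx2 (R : realType) (f g h k : R -> R) (t df dg dh dk : R) :
  is_derive t 1 f df -> is_derive t 1 g dg -> is_derive t 1 h dh ->
  is_derive t 1 k dk ->
  is_derive t 1 (fun t => mx2 (f t) (g t) (h t) (k t)) (mx2 df dg dh dk).
Proof.
move=> Df Dg Dh Dk.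
have D i j : is_derive t 1 (fun t => mx2 (f t) (g t) (h t) (k t) i j)
    (mx2 df dg dh dk i j).
  rewrite (_ : (fun t => _) = fun t =>
      nth 0 (nth [::] [:: [:: f t; g t]; [:: h t; k t]] i) j); last first.
    by apply/funext => s; rewrite mxE.
  rewrite mxE; case: i => -[|[|//]] /= _; case: j => -[|[|//]] /= _; assumption.
have dM : derivable (fun t => mx2 (f t) (g t) (h t) (k t)) t 1.
  by apply/derivable_mxP => i j; have [] := D i j.
apply: DeriveDef => //; rewrite derive_mx//.
by apply/matrixP => i j; rewrite mxE; have [_ ->] := D i j.
Qed.

(** Take [eps = |x t1 - p|] at a time where [x t1 != p]. However small [delta] is, the solution
    restarted at a sufficiently early [t0] begins within [delta] of [p] and is at distance exactly
    [eps] after the time [t1 - t0]. *)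
Lemma unstable_of_branch (R : realType) (V : normedModType R) (D : set V)
    (f : V -> V) (p : V) (tau : R) (x : R -> V) :
  is_equilibrium D f p ->
  (forall t, t < tau -> D (x t)) ->
  (forall t, t < tau -> is_derive t 1 x (f (x t))) ->
  (forall e, 0 < e -> exists T, forall t, t < T -> `|x t - p| < e) ->
  (exists2 t, t < tau & x t != p) ->
  unstable_equilibrium D f p.
Proof.
move=> pE xD dx xp [t1 t1tau xt1]; split=> // st.
have e0 : 0 < `|x t1 - p| by rewrite normr_gt0 subr_eq0.
have [delta delta0 stab] := st _ e0.
have [T xT] := xp _ delta0.
pose t0 := Num.min T t1 - 1.
have t0T : t0 < T by rewrite /t0 ltrBlDr ltr_pwDr// ge_min lexx.
have t01 : t0 < t1 by rewrite /t0 ltrBlDr ltr_pwDr// ge_min lexx orbT.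
have sol : is_solution D f (tau - t0) (fun t => x (t0 + t)).
  have dxs t : t < tau - t0 -> is_derive t 1 (fun t => x (t0 + t)) (f (x (t0 + t))).
    by move=> tt; apply: is_derive_translate; apply: dx; rewrite addrC -ltrBrDr.
  split=> [t /andP[_ tt]| |t /andP[_]]; [|  |exact: dxs].
    by apply: xD; rewrite addrC -ltrBrDr.
  apply: continuous_in_subspaceT => t; rewrite inE/= in_itv/= => /andP[_ /dxs].
  by case=> + _; move/derivable1_diffP; exact: differentiable_continuous.
have := stab _ _ sol; rewrite addr0 => /(_ (xT _ t0T) (t1 - t0)).
rewrite subrKC ltxx => H; have : false by apply: H; rewrite subr_ge0 ltW//= ltrD2r.
by [].
Qed.

(** * The gas system *)

(** The defaults of [nth] pad with zeros, so an empty list stands for a zero row. *)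
Definition mx_rows (R : realType) (rows : seq (seq R)) : 'M[R]_7 :=
  \matrix_(i, j) nth 0 (nth [::] rows i) j.

(* Deviations from the equilibrium in the frame rotating at the rate [a / 2], in
   the coordinates [(p, q, d1, d2, e, f1, f2)] of [gas_state] below; the vector
   field is [u |-> u *m (gas_linear_part + gas_quadratic_part u)]. *)
Definition gas_linear_part (R : realType) (a gamma : R) : 'M[R]_7 :=
  mx_rows
    [:: [:: 0; - 2 * a; 0; 0; - 2 * gamma; 0; 0];
        [:: 2 * a; 0; 0; 0; 0; 0; 0];
        [:: 0; 0; 0; - a; 0; 2; 0];
        [:: 0; 0; a; 0; 0; 0; 2];
        [:: - a ^+ 2; 0; 0; 0; 0; 0; 0];
        [:: 0; 0; a ^+ 2; 0; 0; 0; a];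
        [:: 0; 0; 0; a ^+ 2; 0; - a; 0]].

(** Row [i] multiplies the coordinate [u_i]: each quadratic monomial is attributed to one of its
    factors. None is attributed to [e], whence the empty row. *)
Definition gas_quadratic_part (R : realType) (gamma : R) (u : 'rV[R]_7) :
    'M[R]_7 :=
  let c (k : nat) : R := u 0 (inord k) in
  mx_rows
    [:: [:: - c 0%N; - 2 * c 1%N; - 2 * c 2%N; - 2 * c 3%N;
          - 2 * gamma * c 4%N; - 2 * gamma * c 5%N; - 2 * gamma * c 6%N];
        [:: c 1%N; 0; 0; 0; 0; 0; 0];
        [:: - c 2%N; 0; 0; 0; 0; 2 * c 4%N; 0];
        [:: - c 3%N; 0; 0; 0; 0; 0; 2 * c 4%N];
        [::];
        [:: 0; 0; 0; 0; 2 * c 2%N; 0; 2 * c 1%N];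
        [:: 0; 0; 0; 0; 2 * c 3%N; - 2 * c 1%N; 0]].

Lemma gas_quadratic_part_is_linear (R : realType) (gamma : R) :
  linear (@gas_quadratic_part R gamma).
Proof.
move=> x u v; apply/matrixP => i j; rewrite !mxE.
case: i => -[|[|[|[|[|[|[|//]]]]]]] /= _;
case: j => -[|[|[|[|[|[|[|//]]]]]]] /= _; rewrite ?mxE; ring.
Qed.

HB.instance Definition _ (R : realType) (gamma : R) :=
  GRing.isLinear.Build R 'rV[R]_7 'M[R]_7 _ (@gas_quadratic_part R gamma)
    (gas_quadratic_part_is_linear gamma).

Lemma sum7 (R : realType) (f : 'I_7 -> R) (c := fun k : nat => f (inord k)) :
  \sum_i f i = c 0%N + c 1%N + c 2%N + c 3%N + c 4%N + c 5%N + c 6%N.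
Proof.
rewrite !big_ord_recr big_ord0/= add0r /c.
by do !congr (_ + _); congr f; apply/val_inj; rewrite /= inordK.
Qed.

(** The right-hand sides of [gas_field_state] after the change of frame, which replaces [2 * omega]
    by [a] in the equations of [d1], [d2] and [2 * (q - b)] by [2 * q + a] in those of [f1],
    [f2]. *)
Definition gas_reduced_field (R : realType) (a gamma : R) (c : nat -> R) :
    seq R :=
  let: (p, q, d1, d2, e, f1, f2) :=
    (c 0%N, c 1%N, c 2%N, c 3%N, c 4%N, c 5%N, c 6%N) in
  [:: - p ^+ 2 + 2 * a * q + q ^+ 2 - (d1 ^+ 2 + d2 ^+ 2) - a ^+ 2 * e;
      - 2 * p * (a + q);
      - 2 * p * d1 + a ^+ 2 * f1 + a * d2;
      - 2 * p * d2 + a ^+ 2 * f2 - a * d1;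
      - 2 * gamma * p * (1 + e) + 2 * (f1 * d1 + f2 * d2);
      2 * (1 + e) * d1 - 2 * gamma * p * f1 - (2 * q + a) * f2;
      2 * (1 + e) * d2 - 2 * gamma * p * f2 + (2 * q + a) * f1].

Lemma gas_reduced_fieldE (R : realType) (a gamma : R) (u : 'rV[R]_7) i :
  (u *m (gas_linear_part a gamma + gas_quadratic_part gamma u)) 0 i =
  nth 0 (gas_reduced_field a gamma (fun k => u 0 (inord k))) i.
Proof.
rewrite mxE sum7 !mxE !inordK//.
by case: i => -[|[|[|[|[|[|[|//]]]]]]] /= _; ring.
Qed.

(** The linear part splits into the blocks [(p, q, e)] and [(d1, d2, f1, f2)]. The eigenvector lies
    in the second one, which is the [beta] equation: [d1 = a ^ 2], [d2 = 0], [f1 = |a|],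
    [f2 = a]. *)
Lemma gas_linear_part_eigenvalue (R : realType) (a gamma : R) : a != 0 ->
  eigenvalue (gas_linear_part a gamma) `|a|.
Proof.
move=> a0; have aa : `|a| * `|a| = a * a by rewrite -!expr2 real_normK ?num_real.
apply/eigenvalueP; exists (\row_i [:: 0; 0; a ^+ 2; 0; 0; `|a|; a]`_i).
  apply/rowP => i; rewrite mxE sum7 !mxE !inordK//.
  by case: i => -[|[|[|[|[|[|[|//]]]]]]] /= _; rewrite ?mulrDr; ring: aa.
by apply/rV0Pn; exists (inord 6); rewrite mxE inordK.
Qed.

(* [gas_state] encodes the matrices as the maps [z |-> c z + d conj z] of the
   complex plane: [c = p + i (q - b)], [d = d1 + i d2] for the velocity, and
   [c = k (1 + e)], [d = - k (f1 + i f2)] for the symmetric matrix. *)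
Definition gas_state (R : realType) (k b p q d1 d2 e f1 f2 : R) :
    'M[R]_2 * 'M[R]_2 :=
  (k *: mx2 (1 + e - f1) (- f2) (- f2) (1 + e + f1),
   mx2 (p + d1) (- (q - b) + d2) (q - b + d2) (p - d1)).

(** The time derivative of [gas_state], in which the constants [1] and [b] disappear. *)
Definition gas_velocity (R : realType) (k p q d1 d2 e f1 f2 : R) :
    'M[R]_2 * 'M[R]_2 :=
  (k *: mx2 (e - f1) (- f2) (- f2) (e + f1),
   mx2 (p + d1) (- q + d2) (q + d2) (p - d1)).

(** The gas equations in the complex coordinates, still in the original frame. The relation between
    [k], [c0] and [a] admits [k = a = 0], the case of the branch with [R = 0]. *)
Lemma gas_field_state (R : realType) (omega c0 gamma k b p q d1 d2 e f1 f2 : R)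
    (a := omega - b) :
  k * (2 * c0) = a ^+ 2 ->
  gas_field omega c0 gamma (gas_state k b p q d1 d2 e f1 f2) =
  gas_velocity k
    (- p ^+ 2 + 2 * a * q + q ^+ 2 - (d1 ^+ 2 + d2 ^+ 2) - a ^+ 2 * e)
    (- 2 * p * (a + q))
    (- 2 * p * d1 + a ^+ 2 * f1 + 2 * omega * d2)
    (- 2 * p * d2 + a ^+ 2 * f2 - 2 * omega * d1)
    (- 2 * gamma * p * (1 + e) + 2 * (f1 * d1 + f2 * d2))
    (2 * (1 + e) * d1 - 2 * gamma * p * f1 - 2 * (q - b) * f2)
    (2 * (1 + e) * d2 - 2 * gamma * p * f2 + 2 * (q - b) * f1).
Proof.
move=> kc; rewrite -kc; congr (_, _); apply/matrixP => i j;
  rewrite !mxE ?/mxtrace !big_ord_recl !big_ord0 !mxE -?val_eqE/=;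
  case: i => -[|[|//]] /= _; case: j => -[|[|//]] /= _.
all: by rewrite ?mulr1n ?mulr0n; move: kc; rewrite /a => kc; (ring || lra).
Qed.

(** The two functions are the real and imaginary parts of [(f + i g) exp (i psi t)]. *)
Lemma is_derive_rotation (R : realType) (f g : R -> R) (psi t df dg : R) :
  is_derive t 1 f df -> is_derive t 1 g dg ->
  is_derive t 1 (fun t => f t * cos (psi * t) - g t * sin (psi * t))
    (df * cos (psi * t) - dg * sin (psi * t) -
     psi * (f t * sin (psi * t) + g t * cos (psi * t))) /\
  is_derive t 1 (fun t => f t * sin (psi * t) + g t * cos (psi * t))
    (df * sin (psi * t) + dg * cos (psi * t) +
     psi * (f t * cos (psi * t) - g t * sin (psi * t))).
Proof.
move=> Df Dg.
have Dl : is_derive t 1 (fun t => psi * t) psi.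
  apply: (is_derive_eq (is_deriveZ psi (is_derive_id t 1))).
  by rewrite /GRing.scale/= mulr1.
have Dc : is_derive t 1 (fun t => cos (psi * t)) (- sin (psi * t) * psi).
  exact: (@is_derive1_comp _ cos (fun t => psi * t)).
have Ds : is_derive t 1 (fun t => sin (psi * t)) (cos (psi * t) * psi).
  exact: (@is_derive1_comp _ sin (fun t => psi * t)).
split.
- apply: (is_derive_eq (is_deriveB (is_deriveM Df Dc) (is_deriveM Dg Ds))).
  by rewrite /GRing.scale/=; ring.
- apply: (is_derive_eq (is_deriveD (is_deriveM Df Ds) (is_deriveM Dg Dc))).
  by rewrite /GRing.scale/=; ring.
Qed.

Lemma is_derive_gas_state (R : realType) (k b : R)
    (p q d1 d2 e f1 f2 : R -> R) (t dp dq dd1 dd2 de df1 df2 : R) :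
  is_derive t 1 p dp -> is_derive t 1 q dq -> is_derive t 1 d1 dd1 ->
  is_derive t 1 d2 dd2 -> is_derive t 1 e de -> is_derive t 1 f1 df1 ->
  is_derive t 1 f2 df2 ->
  is_derive t 1 (fun t => gas_state k b (p t) (q t) (d1 t) (d2 t) (e t)
      (f1 t) (f2 t))
    (gas_velocity k dp dq dd1 dd2 de df1 df2).
Proof.
move=> Dp Dq Dd1 Dd2 De Df1 Df2.
have Dcst x : is_derive t 1 (fun=> x) (0 : R) by exact: is_derive_cst.
have De1 : is_derive t 1 (fun t => 1 + e t) de.
  by apply: (is_derive_eq (is_deriveD (Dcst 1) De)); rewrite add0r.
have Dqb : is_derive t 1 (fun t => q t - b) dq.
  by apply: (is_derive_eq (is_deriveB Dq (Dcst b))); rewrite subr0.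
apply: is_derive_pair.
  apply: is_deriveZ; exact: (is_derive_mx2 (is_deriveB De1 Df1)
    (is_deriveN Df2) (is_deriveN Df2) (is_deriveD De1 Df1)).
exact: (is_derive_mx2 (is_deriveD Dp Dd1) (is_deriveD (is_deriveN Dqb) Dd2)
  (is_deriveD Dqb Dd2) (is_deriveB Dp Dd1)).
Qed.

Lemma gas_state_symmetric (R : realType) (k b p q d1 d2 e f1 f2 : R) :
  phase_space (gas_state k b p q d1 d2 e f1 f2).
Proof.
rewrite /phase_space/=; apply/matrixP => i j; rewrite !mxE.
by case: i => -[|[|//]] /= _; case: j => -[|[|//]] /= _.
Qed.

Lemma gas_state_equilibrium (R : realType) (omega c0 b : R) :
  (R_star omega c0 b, Q_star b) =
  gas_state ((omega - b) ^+ 2 / (2 * c0)) b 0 0 0 0 0 0 0.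
Proof.
congr (_, _); apply/matrixP => i j; rewrite !mxE -?val_eqE/=;
  case: i => -[|[|//]] /= _; case: j => -[|[|//]] /= _.
all: by rewrite ?mulr1n ?mulr0n; ring.
Qed.

Lemma gas_star_is_equilibrium (R : realType) (omega c0 gamma b : R) :
  c0 != 0 ->
  is_equilibrium (@phase_space R) (gas_field omega c0 gamma)
    (R_star omega c0 b, Q_star b).
Proof.
move=> c00; rewrite gas_state_equilibrium; split.
  exact: gas_state_symmetric.
rewrite gas_field_state; last by field.
congr (_, _); apply/matrixP => i j; rewrite !mxE;
  case: i => -[|[|//]] /= _; case: j => -[|[|//]] /= _; ring.
Qed.

Lemma gas_state_norm_le (R : realType) (k b p q d1 d2 e f1 f2 M : R) :
  `|p| <= M -> `|q| <= M -> `|d1| <= M -> `|d2| <= M -> `|e| <= M ->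
  `|f1| <= M -> `|f2| <= M ->
  `|gas_state k b p q d1 d2 e f1 f2 - gas_state k b 0 0 0 0 0 0 0| <=
  2 * (`|k| + 1) * M.
Proof.
rewrite !ler_norml => hp hq hd1 hd2 he hf1 hf2.
have M0 : 0 <= M by move: hp; lra.
have k0 := normr_ge0 k.
have kM : 0 <= `|k| * M by rewrite mulr_ge0.
rewrite prod_normE/= ge_max; apply/andP; split.
  rewrite -scalerBr normrZ.
  apply: (@le_trans _ _ (`|k| * (2 * M))); last by lra.
  apply: ler_wpM2l => //; apply: mx_norm_le_entry => [|i j]; first lra.
  rewrite !mxE.
  by case: i => -[|[|//]] /= _; case: j => -[|[|//]] /= _; rewrite ler_norml; lra.
apply: (@le_trans _ _ (2 * M)); last by lra.
apply: mx_norm_le_entry => [|i j]; first lra.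
rewrite !mxE.
by case: i => -[|[|//]] /= _; case: j => -[|[|//]] /= _; rewrite ler_norml; lra.
Qed.

Lemma gas_state_inj0 (R : realType) (k b p q d1 d2 e f1 f2 : R) : k != 0 ->
  gas_state k b p q d1 d2 e f1 f2 = gas_state k b 0 0 0 0 0 0 0 ->
  [/\ p = 0, q = 0, d1 = 0 /\ d2 = 0, e = 0 & f1 = 0 /\ f2 = 0].
Proof.
move=> k0 E.
have /(scalerI k0)/matrixP A := congr1 fst E.
have /matrixP B := congr1 snd E.
have := (A ord0 ord0, A ord0 ord_max, A ord_max ord_max).
have := (B ord0 ord0, B ord0 ord_max, B ord_max ord0, B ord_max ord_max).
rewrite !mxE/= => -[[[B1 B2] B3] B4] [[A1 A2] A3].
by split; [| |split| |split]; lra.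
Qed.

(* The branch is [R = 0], [Q = Q_star + t^-1 E]. *)
Lemma unstable_nonrotating (R : realType) (omega c0 gamma : R) : c0 != 0 ->
  unstable_equilibrium (@phase_space R) (gas_field omega c0 gamma)
    (R_star omega c0 omega, Q_star omega).
Proof.
move=> c00; have eqE := gas_star_is_equilibrium omega gamma omega c00.
move: eqE; rewrite gas_state_equilibrium subrr expr0n/= mul0r => eqE.
apply: (@unstable_of_branch _ _ _ _ _ 0
  (fun t => gas_state 0 omega t^-1 0 0 0 0 0 0)) => //.
- by move=> t _; exact: gas_state_symmetric.
- move=> t t0; have tn0 : t != 0 by rewrite lt_eqF.
  rewrite gas_field_state; last by rewrite mul0r subrr expr0n.
  have Dt : is_derive t 1 (fun t : R => t^-1) (- t^-1 ^+ 2).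
    apply: DeriveDef; first exact: (@derivableV _ _ id).
    by rewrite (@deriveV _ _ id)// derive_id /GRing.scale/= mulr1 exprVn.
  have Dcst x : is_derive t 1 (fun=> x) (0 : R) by exact: is_derive_cst.
  apply: is_derive_eq.
    exact: (is_derive_gas_state 0 omega Dt (Dcst 0) (Dcst 0) (Dcst 0) (Dcst 0)
      (Dcst 0) (Dcst 0)).
  by rewrite /gas_velocity !scale0r; congr (_, mx2 _ _ _ _); ring.
- move=> e e0; exists (- (4 / e)) => t te.
  have e4 : 0 < 4 / e by rewrite divr_gt0.
  have t0 : t < 0 by lra.
  apply: (@le_lt_trans _ _ (2 * (`|0 : R| + 1) * `|t^-1|)).
    by apply: gas_state_norm_le; rewrite ?normr0.
  rewrite normr0 normfV ltr0_norm// add0r mulr1 ltr_pdivrMr ?oppr_gt0//.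
  by move: te; rewrite ltrNr ltr_pdivrMr// mulrC; lra.
- exists (- 1); first by rewrite oppr_lt0 ltr01.
  apply/eqP => /(congr1 snd)/= /matrixP /(_ ord0 ord0); rewrite !mxE/= invrN1.
  by lra.
Qed.

Lemma unstable_rotating (R : realType) (omega c0 gamma b : R) : c0 != 0 ->
  omega - b != 0 ->
  unstable_equilibrium (@phase_space R) (gas_field omega c0 gamma)
    (R_star omega c0 b, Q_star b).
Proof.
move=> c00 a0; have eqE := gas_star_is_equilibrium omega gamma b c00.
set a := omega - b in a0; set k := a ^+ 2 / (2 * c0).
have k0 : k != 0 by rewrite mulf_neq0 ?expf_neq0 ?invr_neq0 ?mulf_neq0 ?pnatr_eq0.
have kc : k * (2 * c0) = a ^+ 2 by rewrite /k; field.
have la : 0 < `|a| by rewrite normr_gt0.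
have [tau [z [dz z0 [t1 t1tau zt1]]]] :=
  unstable_branch (@gas_quadratic_part R gamma) la
    (gas_linear_part_eigenvalue gamma a0).
pose c i t : R := z t 0 (inord i).
(* Relative to the original frame, the frame of rate [a / 2] turns at
   [a / 2 - omega = - (omega + b) / 2]. Coefficients of [conj z] turn twice as fast, while those of
   [z] are unaffected. *)
pose C t := cos (- (omega + b) * t); pose S t := sin (- (omega + b) * t).
have dc i t : (i < 7)%N -> t < tau ->
    is_derive t 1 (c i) (gas_reduced_field a gamma (c^~ t))`_i.
  move=> i7 /(dz t (inord i)).
  by rewrite gas_reduced_fieldE inordK.
pose rot1 i j t := c i t * C t - c j t * S t.
pose rot2 i j t := c i t * S t + c j t * C t.
pose x t := gas_state k b (c 0%N t) (c 1%N t) (rot1 2 3 t) (rot2 2 3 t)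
  (c 4%N t) (rot1 5 6 t) (rot2 5 6 t).
move: eqE; rewrite gas_state_equilibrium -/a -/k => eqE.
apply: (@unstable_of_branch _ _ _ _ _ tau x) => //.
- by move=> t _; exact: gas_state_symmetric.
- move=> t tt; rewrite gas_field_state//.
  (* This is the one trigonometric identity involved: it expresses that [d1 ^ 2 + d2 ^ 2] and
     [f1 d1 + f2 d2] are invariant under the rotation. *)
  have SS : S t ^+ 2 = 1 - C t ^+ 2 by exact: sin2cos2.
  have [Dd1 Dd2] := is_derive_rotation (- (omega + b))
    (dc 2 t isT tt) (dc 3 t isT tt).
  have [Df1 Df2] := is_derive_rotation (- (omega + b))
    (dc 5 t isT tt) (dc 6 t isT tt).
  apply: is_derive_eq.
    exact: (is_derive_gas_state k b (dc 0%N t isT tt) (dc 1%N t isT tt) Dd1 Dd2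
      (dc 4%N t isT tt) Df1 Df2).
  rewrite /= -/(C t) -/(S t) /rot1 /rot2 /a.
  by congr (gas_velocity _ _ _ _ _ _ _ _); ring: SS.
(* In [K], the factor [2 * (|k| + 1)] comes from [gas_state_norm_le] and the last [2] from the
   rotated coordinates, each a combination of two entries of [z t]. *)
- move=> e e0; pose K := 2 * (`|k| + 1) * 2.
  have K0 : 0 < K by rewrite !mulr_gt0// ltr_wpDl.
  have [T zT] := z0 (e / K) (divr_gt0 e0 K0).
  exists T => t /zT; rewrite ltr_pdivlMr// mulrC => ze.
  apply: le_lt_trans ze; rewrite /K -[leRHS]mulrA.
  have cz i : `|c i t| <= `|z t| by exact: le_mx_norm_entry.
  have C1 : `|C t| <= 1 by rewrite ler_norml cos_geN1 cos_le1.
  have S1 : `|S t| <= 1 by rewrite ler_norml sin_geN1 sin_le1.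
  have cC i : `|c i t * C t| <= `|z t| by rewrite normrM -[leRHS]mulr1 ler_pM.
  have cS i : `|c i t * S t| <= `|z t| by rewrite normrM -[leRHS]mulr1 ler_pM.
  have zz : `|z t| <= 2 * `|z t| by rewrite ler_peMl// ler1n.
  have r1 i j : `|rot1 i j t| <= 2 * `|z t|.
    by rewrite (le_trans (ler_normB _ _))// mulr_natl mulr2n lerD.
  have r2 i j : `|rot2 i j t| <= 2 * `|z t|.
    by rewrite (le_trans (ler_normD _ _))// mulr_natl mulr2n lerD.
  by apply: gas_state_norm_le => //; apply: le_trans (cz _) zz.
- exists t1 => //; apply: contra zt1 => /eqP /(gas_state_inj0 k0).
  case=> p0 q0 [r12 r22] e0 [r15 r25].
  have CS : C t1 ^+ 2 + S t1 ^+ 2 = 1 by exact: cos2Dsin2.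
  (* The inverse rotation recovers the original pair of coordinates, so a zero rotated pair forces
     both to vanish. *)
  have rotE i j : rot1 i j t1 = 0 -> rot2 i j t1 = 0 -> c i t1 = 0 /\ c j t1 = 0.
    rewrite /rot1 /rot2 => h1 h2; split.
      rewrite -[LHS]mulr1 -CS (_ : _ * _ = (c i t1 * C t1 - c j t1 * S t1) * C t1 +
        (c i t1 * S t1 + c j t1 * C t1) * S t1); last by ring.
      by rewrite h1 h2 !mul0r addr0.
    rewrite -[LHS]mulr1 -CS (_ : _ * _ = (c i t1 * S t1 + c j t1 * C t1) * C t1 -
      (c i t1 * C t1 - c j t1 * S t1) * S t1); last by ring.
    by rewrite h1 h2 !mul0r subr0.
  have [c2 c3] := rotE _ _ r12 r22; have [c5 c6] := rotE _ _ r15 r25.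
  apply/eqP/rowP => i; rewrite mxE -[i]inord_val -/(c i t1).
  by case: i => -[|[|[|[|[|[|[|//]]]]]]] /= _.
Qed.

Theorem theorem2p4 (R : realType) (omega c0 gamma : R)
    (homega : 0 < omega) (hc0 : c0 != 0) (hgamma : 1 < gamma) (b : R) :
  unstable_equilibrium (@phase_space R) (gas_field omega c0 gamma)
    (R_star omega c0 b, Q_star b).
Proof.
have [<-|nb] := eqVneq omega b; first exact: unstable_nonrotating.
by apply: unstable_rotating; rewrite ?subr_eq0.
Qed.
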